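(* Let $p$ be a prime number and $n$ a positive integer such that $p$ does not divide $n$ and each group of order $np$ has a normal subgroup of order $p$. Let $N=\mathbf{Z}_p\times E$ be an abelian group of order $np$ (so $E$ is abelian of order $n$). The conjugacy classes of regular subgroups of $\mathrm{Hol}(N)$ are in one-to-one correspondence with couples $(F,\tau)$, where $F$ runs over a set of representatives of the conjugacy classes of regular subgroups of $\mathrm{Hol}(E)$ and, for each $F$, $\tau$ runs over a set of representatives of the classes of group morphisms $\tau:F\to\mathrm{Aut}(\mathbf{Z}_p)$ under the relation: $\tau\simeq\tau'$ if and only if $\tau=\tau'\circ\Phi_\nu|_F$ for some $\nu\in\mathrm{Aut}(E)$ with $\Phi_\nu(F)=F$, where $\Phi_\nu$ is the inner automorphism of $\mathrm{Hol}(E)$ given by conjugation by $\nu$. Here the couple $(F,\tau)$ corresponds to the conjugacy class of the regular subgroup $\{((m,\tau(f)),f)\mid m\in\mathbf{Z}_p,\ f\in F\}$ of $(\mathbf{Z}_p\rtimes\mathbf{Z}_p^* )\times\mathrm{Hol}(E)=\mathrm{Hol}(N)$.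
   Context: $\mathbf{Z}_p=\mathbf{Z}/p\mathbf{Z}$, and $\mathrm{Aut}(\mathbf{Z}_p)$ is identified with $\mathbf{Z}_p^*$. For a group $N$, $\mathrm{Hol}(N)=N\rtimes\mathrm{Aut}(N)$, with product $(x,\varphi)(y,\psi)=(x\varphi(y),\varphi\psi)$, acting on $N$ by $(x,\varphi)\cdot y=x\varphi(y)$. A subgroup of $\mathrm{Hol}(N)$ is regular if it acts regularly (transitively with trivial stabilizers) on $N$. For $\nu\in\mathrm{Aut}(E)\subseteq\mathrm{Hol}(E)$, $\Phi_\nu(a,\sigma)=(\nu(a),\nu\sigma\nu^{-1})$. Since $p\nmid|E|$, $\mathrm{Aut}(N)=\mathbf{Z}_p^*\times\mathrm{Aut}(E)$ and $\mathrm{Hol}(N)=(\mathbf{Z}_p\rtimes\mathbf{Z}_p^* )\times\mathrm{Hol}(E)$. *)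

(* Defs.v *)
From HB Require Import structures.
From mathcomp Require Import all_boot all_fingroup zmodp cyclic.

Set Implicit Arguments.
Unset Strict Implicit.
Unset Printing Implicit Defensive.

Import GroupScope.

(* The group law of aut_of gT is that of {perm gT}, where s * t applies s first:
   the composite phi \o psi is written psi * phi. *)
Definition aut_of (gT : finGroupType) := [subg Aut [set: gT]]%type.

Record hol (gT : finGroupType) := Hol { hol_trans : gT; hol_aut : aut_of gT }.

Definition hol_pair (gT : finGroupType) (u : hol gT) : gT * aut_of gT :=
  (hol_trans u, hol_aut u).

Definition pair_hol (gT : finGroupType) (u : gT * aut_of gT) : hol gT :=
  Hol u.1 u.2.

Lemma hol_pairK (gT : finGroupType) : cancel (@hol_pair gT) (@pair_hol gT).
Proof. by case. Qed.

HB.instance Definition _ (gT : finGroupType) :=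
  Finite.copy (hol gT) (can_type (@hol_pairK gT)).

Lemma hol_eq (gT : finGroupType) (u v : hol gT) :
  hol_trans u = hol_trans v ->
  (forall x, sgval (hol_aut u) x = sgval (hol_aut v) x) -> u = v.
Proof.
case: u v => [x a] [y b] /= -> ab; congr Hol.
by apply: val_inj; apply/permP.
Qed.

Lemma autM (gT : finGroupType) (a : aut_of gT) : {morph sgval a : x y / x * y}.
Proof.
by move=> x y; move/morphicP: (Aut_morphic (subgP a)) => -> //; rewrite inE.
Qed.

Lemma aut1 (gT : finGroupType) (a : aut_of gT) : sgval a 1 = 1.
Proof. by apply: (mulgI (sgval a 1)); rewrite -autM !mulg1. Qed.

Definition hol_one (gT : finGroupType) : hol gT := Hol 1 1.

(* (x, phi) (y, psi) = (x phi(y), phi \o psi) *)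
Definition hol_mul (gT : finGroupType) (u v : hol gT) : hol gT :=
  Hol (hol_trans u * sgval (hol_aut u) (hol_trans v)) (hol_aut v * hol_aut u).

Definition hol_inv (gT : finGroupType) (u : hol gT) : hol gT :=
  Hol (sgval (hol_aut u)^-1 (hol_trans u)^-1) (hol_aut u)^-1.

Lemma hol_mulA (gT : finGroupType) : associative (@hol_mul gT).
Proof.
by move=> u v w; congr Hol; rewrite /= ?mulgA // autM permM mulgA.
Qed.

Lemma hol_mul1 (gT : finGroupType) : left_id (@hol_one gT) (@hol_mul gT).
Proof. by case=> x a; congr Hol; rewrite /= ?mulg1 // perm1 mul1g. Qed.

Lemma hol_mulV (gT : finGroupType) :
  left_inverse (@hol_one gT) (@hol_inv gT) (@hol_mul gT).
Proof.
case=> x a; congr Hol; last by rewrite /= mulgV.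
by rewrite [LHS](esym (autM a^-1 _ _)) mulVg aut1.
Qed.

HB.instance Definition _ (gT : finGroupType) :=
  Finite_isGroup.Build (hol gT) (@hol_mulA gT) (@hol_mul1 gT) (@hol_mulV gT).

Definition hol_act (gT : finGroupType) (u : hol gT) (y : gT) : gT :=
  hol_trans u * sgval (hol_aut u) y.

Lemma hol_actM (gT : finGroupType) (u v : hol gT) y :
  hol_act (u * v) y = hol_act u (hol_act v y).
Proof. by rewrite /hol_act /= autM permM mulgA. Qed.

Definition is_regular (gT : finGroupType) (G : {set hol gT}) : bool :=
  [forall x, forall y, exists u in G, hol_act u x == y] &&
  [forall x, forall u in G, (hol_act u x == x) ==> (u == 1)].

Definition regular_subgroups (gT : finGroupType) : {set {group hol gT}} :=
  [set G : {group hol gT} | is_regular G].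

Definition conj_class (hT : finGroupType) (G : {set hT}) : {set {set hT}} :=
  G :^: [set: hT].

Definition conj_subgroups (hT : finGroupType) : rel {group hT} :=
  fun G H => (H : {set hT}) \in conj_class G.

Definition representatives (T : finType) (R : rel T) (A X : {set T}) : bool :=
  is_transversal X (equivalence_partition R A) A.

(* The inner automorphism of Hol(E) given by nu in Aut(E), embedded as (1, nu);
   MathComp's conjugation x ^ y is y^-1 * x * y. *)
Definition Phi (gT : finGroupType) (nu : aut_of gT) (u : hol gT) : hol gT :=
  u ^ (Hol 1 nu)^-1.

Lemma PhiE (gT : finGroupType) (nu : aut_of gT) (a : gT) (s : aut_of gT) :
  Phi nu (Hol a s) = Hol (sgval nu a) (nu^-1 * s * nu).
Proof.
rewrite /Phi conjgE invgK; congr Hol.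
rewrite /= invg1; set e := (X in sgval s X); have -> : e = 1 := aut1 nu^-1.
by rewrite aut1 mulg1 mul1g.
Qed.

(* Group morphisms F -> Aut(Z_p), as finite functions, so that equality of
   morphisms is pointwise equality on F.  The group law of 'Z_p is addition, and
   since Aut(Z_p) is abelian the order of composition does not matter. *)
Definition homs (p : nat) (E : finGroupType) (F : {group hol E}) :
    {set {ffun [subg F] -> aut_of 'Z_p}} :=
  [set tau : {ffun [subg F] -> aut_of 'Z_p} | morphic [set: [subg F]] tau].

(* tau = tau' \o Phi_nu|_F for some nu with Phi_nu(F) = F. The projection subg F
   restores the membership in F, lost through the coercion sgval. *)
Definition sim (p : nat) (E : finGroupType) (F : {group hol E}) :
    rel {ffun [subg F] -> aut_of 'Z_p} :=
  fun tau tau' =>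
    [exists nu : aut_of E, (Phi nu @: F == F) &&
       [forall f : [subg F], tau f == tau' (subg F (Phi nu (sgval f)))]].

Definition prod_fun (A B : finGroupType) (a : aut_of A) (b : aut_of B)
    (x : A * B) : A * B := (sgval a x.1, sgval b x.2).

Lemma prod_fun_inj (A B : finGroupType) (a : aut_of A) (b : aut_of B) :
  injective (prod_fun a b).
Proof. by move=> [x y] [x' y'] [/perm_inj-> /perm_inj->]. Qed.

Lemma prod_fun_Aut (A B : finGroupType) (a : aut_of A) (b : aut_of B) :
  perm (@prod_fun_inj A B a b) \in Aut [set: A * B].
Proof.
rewrite inE; apply/andP; split; first by apply/subsetP=> x; rewrite inE.
apply/morphicP=> x y _ _; rewrite !permE.
by rewrite /prod_fun /= !autM.
Qed.

Definition aut_prod (A B : finGroupType) (a : aut_of A) (b : aut_of B) :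
    aut_of (A * B)%type := Subg (prod_fun_Aut a b).

(* The embedding Hol(A) x Hol(B) -> Hol(A x B); for A and B of coprime orders
   it is an isomorphism (hol_prodM, hol_prod_inj, hol_prod_onto), compatible
   with the actions, through which the two groups are identified. *)
Definition hol_prod (A B : finGroupType) (w : hol A * hol B) :
    hol (A * B)%type :=
  Hol (hol_trans w.1, hol_trans w.2) (aut_prod (hol_aut w.1) (hol_aut w.2)).

Lemma hol_prodM (A B : finGroupType) :
  {morph @hol_prod A B : u v / u * v}.
Proof.
move=> [u u'] [v v']; apply: hol_eq => [|x] /=.
  by rewrite permE.
by rewrite permM !permE /prod_fun /= !permM.
Qed.

Lemma hol_prod_act (A B : finGroupType) (u : hol A) (v : hol B) x y :
  hol_act (hol_prod (u, v)) (x, y) = (hol_act u x, hol_act v y).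
Proof. by rewrite /hol_act /= permE. Qed.

Lemma hol_prod_inj (A B : finGroupType) : injective (@hol_prod A B).
Proof.
move=> [u u'] [v v'] eq_uv.
have E x y := congr1 (fun w => sgval (hol_aut w) (x, y)) eq_uv.
case: (congr1 (@hol_trans _) eq_uv) => eq1 eq2.
congr pair; apply: hol_eq => // x.
  by move: (E x 1); rewrite /= !permE => -[].
by move: (E 1 x); rewrite /= !permE => -[].
Qed.

Lemma hol_prod_onto (A B : finGroupType) (u : hol (A * B)%type) :
  coprime #|A| #|B| -> exists w, hol_prod w = u.
Proof.
move=> coAB; case: u => [[s t] c].
have co_eq1 (gT : finGroupType) m (x : gT) :
    coprime #|gT| m -> x ^+ m = 1 -> x = 1.
  move=> co xm; apply/eqP; rewrite -order_eq1 -dvdn1 -(eqP co) dvdn_gcd.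
  apply/andP; split; last by rewrite order_dvdn xm.
  by rewrite -cardsT; apply: order_dvdG; rewrite inE.
have cX x k : sgval c (x ^+ k) = sgval c x ^+ k.
  by elim: k => [|k IHk]; rewrite ?aut1 // !expgS autM IHk.
have pX (x : A * B) k : x ^+ k = (x.1 ^+ k, x.2 ^+ k).
  by elim: k => [|k IHk] //; rewrite !expgS IHk.
have xT (gT : finGroupType) (x : gT) : x ^+ #|gT| = 1.
  by rewrite -cardsT; apply: expg_cardG; rewrite inE.
have c2 x : (sgval c (x, 1)).2 = 1.
  apply: (@co_eq1 _ #|A|); first by rewrite coprime_sym.
  have := cX (x, 1) #|A|; rewrite pX /= xT expg1n aut1 pX.
  by case.
have c1 y : (sgval c (1, y)).1 = 1.
  apply: (@co_eq1 _ #|B|) => //.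
  have := cX (1, y) #|B|; rewrite pX /= xT expg1n aut1 pX.
  by case.
pose f x := (sgval c (x, 1)).1; pose g y := (sgval c (1, y)).2.
have cE x y : sgval c (x, y) = (f x, g y).
  have -> : (x, y) = (x, 1) * (1, y) :> A * B.
    by congr pair; rewrite /= ?mulg1 ?mul1g.
  rewrite autM /f /g; case: (sgval c (x, 1)) (c2 x) => a b /= ->.
  case: (sgval c (1, y)) (c1 y) => a' b' /= ->.
  by congr pair; rewrite /= ?mulg1 ?mul1g.
have f_inj : injective f.
  move=> x x' fxx'; suff: (x, 1 : B) = (x', 1) by case.
  by apply: (@perm_inj _ (sgval c)); rewrite !cE fxx'.
have g_inj : injective g.
  move=> y y' gyy'; suff: (1 : A, y) = (1, y') by case.
  by apply: (@perm_inj _ (sgval c)); rewrite !cE gyy'.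
have fM x x' : f (x * x') = f x * f x'.
  have := autM c (x, 1) (x', 1).
  have -> : (x, 1) * (x', 1) = (x * x', 1) :> A * B.
    by congr pair; rewrite mulg1.
  by rewrite !cE => -[].
have gM y y' : g (y * y') = g y * g y'.
  have := autM c (1, y) (1, y').
  have -> : (1, y) * (1, y') = (1, y * y') :> A * B.
    by congr pair; rewrite mulg1.
  by rewrite !cE => -[].
have fA : perm f_inj \in Aut [set: A].
  rewrite inE; apply/andP; split; first by apply/subsetP=> x; rewrite inE.
  by apply/morphicP=> x y _ _; rewrite !permE fM.
have gA : perm g_inj \in Aut [set: B].
  rewrite inE; apply/andP; split; first by apply/subsetP=> x; rewrite inE.
  by apply/morphicP=> x y _ _; rewrite !permE gM.
exists (Hol s (Subg fA), Hol t (Subg gA)); apply: hol_eq => // -[x y].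
by rewrite cE /= permE /prod_fun /= !permE.
Qed.

Definition couple (p : nat) (E : finGroupType) : finType :=
  {F : {group hol E} & {ffun [subg F] -> aut_of 'Z_p}}.

Definition couples (p : nat) (E : finGroupType) (Fs : {set {group hol E}})
    (T : forall F : {group hol E}, {set {ffun [subg F] -> aut_of 'Z_p}}) :
    {set couple p E} :=
  [set c : couple p E | (tag c \in Fs) && (tagged c \in T (tag c))].

(* {((m, tau(f)), f) | m in Z_p, f in F} *)
Definition couple_subgroup (p : nat) (E : finGroupType) (c : couple p E) :
    {set hol ('Z_p * E)%type} :=
  [set hol_prod (Hol m (tagged c f), sgval f) | m : 'Z_p, f : [subg (tag c)]].

(* Main.v *)
Require Import Defs.
From mathcomp Require Import all_boot all_fingroup zmodp.
From mathcomp Require Import gproduct cyclic pgroup sylow.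

Set Implicit Arguments.
Unset Strict Implicit.
Unset Printing Implicit Defensive.

Import GroupScope.

(** Every subgroup in sight is handled through the isomorphism hol_prod of
    Hol('Z_p) x Hol(E) with Hol('Z_p x E), so a subgroup of Hol(N) is a set of
    pairs ((m, t), v) with m in 'Z_p, t in Aut('Z_p) and v in Hol(E).

    Onto: every regular subgroup G of Hol(N) is itself, before any conjugation,
    the subgroup of some couple (F, tau). Let P be normal of order p in G. Its
    projection to Hol(E) is a normal p-subgroup of a transitive group on E; as
    p does not divide #|E|, it has a fixed point, hence, being normal, fixes
    everything (normal_pgroup_trivial). So P lies in Hol('Z_p), and since
    Aut('Z_p) has order p - 1, P consists of all the translations of 'Z_p
    (regular_translations). Multiplying by these, m can be changed at will
    inside G; since an element of G is known from its action on one point, t is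
    then a function tau of v, and G is the subgroup of (F, tau), with F the
    projection of G to Hol(E) (regular_couple).

    One-to-one: Aut('Z_p) is abelian, so conjugating by (a, b) does not change
    the component t. Hence the subgroups of (F, tau) and (F', tau') are
    conjugate exactly when some b conjugates F to F' and carries tau to tau'
    (couple_class_eqP). For F = F' this is the relation sim (simE): F is
    transitive, so b can be multiplied by an element of F to fix the neutral
    element of E, that is, to come from Aut(E), and that element of F acts
    trivially on morphisms from F to an abelian group.

    Both relations of the statement are thus equalities of conjugacy classes,
    and the choice of representatives is dealt with uniformly by
    representativesP. *)

(** * Systems of representatives *)

(** Once R is equality of some invariant k, it is automatically an equivalence
    relation, and a transversal X is a set on which k is injective and takes
    all its values. *)
Lemma representativesP (I : finType) (J : eqType) (k : I -> J) (R : rel I)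
    (A X : {set I}) :
    {in A &, forall x y, R x y = (k x == k y)} -> representatives R A X ->
  [/\ {subset X <= A}, {in X &, injective k} &
      forall x, x \in A -> exists2 y, y \in X & k x = k y].
Proof.
move=> Rk /and3P[_ /subsetP sXA /forall_inP X1].
have meet_class x : x \in A -> #|X :&: [set y in A | R x y]| == 1%N.
  by move=> Ax; apply: X1; apply: imset_f.
split=> // [x y Xx Xy kxy|x Ax]; last first.
  have /cards1P[y /setP/(_ y)] := meet_class x Ax.
  rewrite !inE eqxx => /and3P[Xy Ay]; rewrite Rk // => /eqP kxy.
  by exists y.
have /cards1P[z /setP defz] := meet_class x (sXA x Xx).
have := defz y; have := defz x; rewrite !inE !Rk ?sXA // kxy eqxx Xx Xy.
by move=> /= zx zy; rewrite (eqP (esym zx)) (eqP (esym zy)).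
Qed.

Lemma conj_class_eqP (hT : finGroupType) (G H : {set hT}) :
  reflect (exists u, G :^ u = H) (conj_class G == conj_class H).
Proof.
apply: (iffP eqP) => [eqGH | [u <-]].
  have: H \in conj_class G.
    by rewrite eqGH; apply/imsetP; exists 1; rewrite ?conjsg1.
  by case/imsetP=> u _ ->; exists u.
apply/setP=> K; apply/imsetP/imsetP=> -[v _ ->].
  by exists (u^-1 * v); rewrite ?inE // -conjsgM mulKVg.
by exists (u * v); rewrite ?inE // conjsgM.
Qed.

Lemma conj_subgroupsE (hT : finGroupType) (G H : {group hT}) :
  conj_subgroups G H = (conj_class G == conj_class H).
Proof.
by apply/imsetP/conj_class_eqP => [[u _ ->]|[u <-]]; exists u; rewrite ?inE.
Qed.

(** * Regular subgroups of a holomorph *)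

Lemma hol_act1 (gT : finGroupType) (y : gT) : hol_act 1 y = y.
Proof. by rewrite /hol_act /= mul1g perm1. Qed.

Lemma is_regularP (gT : finGroupType) (G : {set hol gT}) :
  reflect ((forall x y, exists2 u, u \in G & hol_act u x = y) /\
           (forall x u, u \in G -> hol_act u x = x -> u = 1))
          (is_regular G).
Proof.
apply: (iffP andP) => -[trG freeG]; split.
- move=> x y; have /forallP/(_ y)/exists_inP[u Gu /eqP] := forallP trG x.
  by exists u.
- move=> x u Gu ux; have /forall_inP/(_ u Gu) := forallP freeG x.
  by rewrite ux eqxx => /eqP.
- apply/forallP=> x; apply/forallP=> y; apply/exists_inP.
  by have [u Gu uxy] := trG x y; exists u; rewrite ?uxy.
apply/forallP=> x; apply/forall_inP=> u Gu; apply/implyP=> /eqP ux.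
by rewrite (freeG x u).
Qed.

Lemma regular_eq (gT : finGroupType) (G : {group hol gT}) x u v :
    is_regular G -> u \in G -> v \in G -> hol_act u x = hol_act v x ->
  u = v.
Proof.
case/is_regularP=> _ freeG Gu Gv uv; apply/eqP; rewrite eq_mulVg1; apply/eqP.
apply: (freeG x); first by rewrite groupM ?groupV.
by rewrite hol_actM -uv -hol_actM mulVg hol_act1.
Qed.

Lemma card_regular (gT : finGroupType) (G : {group hol gT}) :
  is_regular G -> #|G| = #|gT|.
Proof.
move=> regG; have [trG _] := is_regularP _ regG.
have inj1 : {in G &, injective (fun u => hol_act u 1)}.
  by move=> u v Gu Gv /=; apply: (regular_eq regG).
rewrite -(card_in_imset inj1) -cardsT; congr #|pred_of_set _|.
apply/setP=> y; rewrite inE; apply/imsetP.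
by have [u Gu <-] := trG 1 y; exists u.
Qed.

Lemma hol_act_faithful (gT : finGroupType) (u : hol gT) :
  (forall y, hol_act u y = y) -> u = 1.
Proof.
move=> fix_u; have tr1 : hol_trans u = 1.
  by have := fix_u 1; rewrite /hol_act aut1 mulg1.
apply: hol_eq => [|x] //=; rewrite perm1.
by have := fix_u x; rewrite /hol_act tr1 mul1g.
Qed.

(** hol_act is a left action, while the congruence for the number of fixed
    points of a p-group, pgroup_fix_mod, is about right actions. *)
Definition hol_ract (gT : finGroupType) (y : gT) (u : hol gT) := hol_act u^-1 y.

Lemma hol_ract1 (gT : finGroupType) : (@hol_ract gT)^~ 1 =1 id.
Proof. by move=> y; rewrite /hol_ract invg1 hol_act1. Qed.

Lemma hol_ractM (gT : finGroupType) (y : gT) : act_morph (@hol_ract gT) y.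
Proof. by move=> u v; rewrite /hol_ract invMg hol_actM. Qed.

(** A p-group acting on a set of cardinal prime to p has a fixed point. The
    fixed points of a normal subgroup P are permuted by F, so by transitivity
    every point is fixed, and Hol acts faithfully. *)
Lemma normal_pgroup_trivial (gT : finGroupType) (p : nat)
    (F P : {group hol gT}) :
    (forall x y, exists2 u, u \in F & hol_act u x = y) ->
    P <| F -> p.-group P -> ~~ (p %| #|gT|) -> forall u, u \in P -> u = 1.
Proof.
move=> trF /andP[_ nPF] pP p_ndvd u Pu.
pose to := TotalAction (@hol_ract1 gT) (@hol_ractM gT).
have /(pgroup_fix_mod pP): [acts P, on [set: gT] | to].
  by apply/subsetP=> v _; rewrite !inE /=; apply/subsetP=> x _; rewrite !inE.
rewrite cardsT => fix_mod.
have [x /setIP[_ fix_x]] : exists x, x \in 'Fix_([set: gT] | to)(P).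
  apply/set0Pn; apply: contraNneq p_ndvd => fix0.
  by rewrite /dvdn fix_mod fix0 cards0 mod0n.
apply: hol_act_faithful => y; have [f Ff <-] := trF x y.
have Puf : (u ^ f)^-1 \in P by rewrite groupV memJ_norm // (subsetP nPF).
have := afixP fix_x _ Puf; rewrite /= /hol_ract invgK => ufx.
by rewrite -{2}ufx -!hol_actM conjgC.
Qed.

(** * The holomorph of a cyclic group of prime order *)

(** hol_aut reverses products, but a power only involves one element. *)
Lemma hol_autX (gT : finGroupType) (u : hol gT) k :
  hol_aut (u ^+ k) = hol_aut u ^+ k.
Proof. by elim: k => // k IHk; rewrite expgS expgSr -IHk. Qed.

Lemma cyclic_Zp p : cyclic [set: 'Z_p].
Proof. by rewrite Zp_cycle; apply: cycle_cyclic. Qed.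

Lemma aut_ZpC p (a b : aut_of 'Z_p) : a * b = b * a.
Proof.
apply: val_inj; apply: (centsP (Aut_cyclic_abelian (cyclic_Zp p))) => //;
  exact: subgP.
Qed.

(** hol_aut is, up to reversal of products, a morphism to an abelian group. *)
Lemma hol_autJ p (u a : hol 'Z_p) : hol_aut (u ^ a) = hol_aut u.
Proof. by rewrite conjgE /= aut_ZpC mulKg. Qed.

(** Aut('Z_p) has order p - 1, prime to p. *)
Lemma aut_Zp_p_elt p (a : aut_of 'Z_p) : prime p -> a ^+ p = 1 -> a = 1.
Proof.
move=> p_pr ap1; apply/eqP; rewrite -order_eq1 -dvdn1.
have <-: gcdn p p.-1 = 1%N.
  by apply/eqP; rewrite -/(coprime _ _) coprimenP ?prime_gt0.
rewrite dvdn_gcd order_dvdn ap1 eqxx /=.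
have -> : p.-1 = #|[set: aut_of 'Z_p]|.
  rewrite -(card_isog (isog_subg (Aut [set: 'Z_p]))).
  rewrite card_Aut_cyclic ?cyclic_Zp // cardsT card_ord.
  by rewrite Zp_cast ?prime_gt1 // totient_prime.
by apply: order_dvdG; rewrite inE.
Qed.

(** * Structure of the regular subgroups of Hol('Z_p x E) *)

Canonical hol_prod_morphism (A B : finGroupType) :=
  @Morphism _ _ [set: hol A * hol B] _ (in2W (@hol_prodM A B)).

(** P has trivial image in Hol(E) because this image is a normal p-subgroup of
    a transitive group; its elements of Hol('Z_p) have order dividing p, hence
    trivial automorphism part, and counting shows that P is the whole group of
    translations. *)
Lemma regular_translations p (E : finGroupType)
    (G P : {group hol ('Z_p * E)%type}) :
    prime p -> ~~ (p %| #|E|) -> is_regular G -> P <| G -> #|P| = p ->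
  forall m : 'Z_p, hol_prod (Hol m 1, 1 : hol E) \in G.
Proof.
move=> p_pr p_ndvd /is_regularP[trG freeG] nPG cardP m.
have cardZ : #|'Z_p| = p by rewrite card_ord Zp_cast ?prime_gt1.
have coZE : coprime #|'Z_p| #|E| by rewrite cardZ prime_coprime.
pose toE := [morphism of @hol_prod 'Z_p E].
have injE : 'injm toE by apply/injmP=> w w' _ _; apply: hol_prod_inj.
have imE (H : {group hol ('Z_p * E)%type}) : H \subset toE @* [set: _].
  apply/subsetP=> u _; have [w <-] := hol_prod_onto u coZE.
  by rewrite mem_morphim ?inE.
have P_E w : hol_prod w \in P -> w.2 = 1.
  move=> Pw; pose F := (snd @* (toE @*^-1 G))%G.
  apply: (@normal_pgroup_trivial E p F (snd @* (toE @*^-1 P))%G) => //.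
  - move=> x y; have [u Gu] := trG (1, x) (1, y).
    case: (hol_prod_onto u coZE) Gu => -[a b] <- Gab.
    rewrite hol_prod_act => -[_ bxy]; exists b => //.
    by apply/morphimP; exists (a, b); rewrite ?inE.
  - by rewrite morphim_normal // morphpre_normal ?imE.
  - rewrite morphim_pgroup // -(injm_pgroup injE) ?subsetT // morphpreK ?imE //.
    by rewrite /pgroup cardP pnat_id.
  by apply/morphimP; exists w; rewrite ?inE.
(* P is contained in the translations, and has as many elements. *)
pose S := [set m' : 'Z_p | hol_prod (Hol m' 1, 1 : hol E) \in P].
suff: S = setT.
  by move/setP/(_ m); rewrite !inE; apply: subsetP (normal_sub nPG) _.
have sPS : P \subset [set hol_prod (Hol m' 1, 1 : hol E) | m' in S].
  apply/subsetP=> u Pu; case: (hol_prod_onto u coZE) Pu => -[[m' t] b] <- Pab.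
  have /= b1 := P_E _ Pab; rewrite b1 in Pab *.
  suff t1 : t = 1 by rewrite t1 in Pab *; apply: imset_f; rewrite inE.
  apply: (aut_Zp_p_elt p_pr).
  have: toE (Hol m' t, 1) ^+ p = toE 1.
    rewrite morph1; apply/eqP.
    by rewrite -order_dvdn -[X in _ %| X]cardP order_dvdG.
  rewrite -morphX ?inE // => /hol_prod_inj/(congr1 fst).
  rewrite -[(_ ^+ p).1]/([morphism of @fst _ _] _) morphX ?inE //=.
  by move/(congr1 (@hol_aut _)); rewrite hol_autX.
apply/eqP; rewrite eqEcard subsetT cardsT cardZ -[leqLHS]cardP.
by rewrite (leq_trans (subset_leq_card sPS)) // leq_imset_card.
Qed.

Local Notation Couple tau :=
  (Tagged (fun F : {group hol _} => {ffun [subg F] -> aut_of _}) tau).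

Lemma mem_couple_subgroup p (E : finGroupType) (c : couple p E) u v :
  (hol_prod (u, v) \in couple_subgroup c)
    = (v \in tag c) && (hol_aut u == tagged c (subg (tag c) v)).
Proof.
apply/imset2P/andP => [[m f _ _ /hol_prod_inj[-> ->]]|[Fv /eqP tau_v]].
  by rewrite subgP sgvalK.
exists (hol_trans u) (subg (tag c) v) => //.
by rewrite -tau_v subgK //; case: u {tau_v}.
Qed.

Lemma homsP p (E : finGroupType) (F : {group hol E})
    (tau : {ffun [subg F] -> aut_of 'Z_p}) :
  reflect {morph tau : f g / f * g} (tau \in homs p F).
Proof.
by rewrite inE; apply: (iffP morphicP) => tauM f g; rewrite tauM ?inE.
Qed.

(** F moves the E-coordinate as required, and the free parameter m then adjusts
    the coordinate in 'Z_p; conversely an element that fixes a point is trivial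
    on E by regularity of F, so it is a translation of 'Z_p with a fixed
    point. *)
Lemma couple_subgroup_regular p (E : finGroupType) (c : couple p E) :
    is_regular (tag c) -> tagged c \in homs p (tag c) ->
  exists2 G : {group hol ('Z_p * E)%type}, is_regular G & couple_subgroup c = G.
Proof.
case: c => F tau /= /is_regularP[trF freeF] /homsP tauM.
set c : couple p E := existT _ F tau.
have tau1 : tau 1 = 1 by apply: (mulgI (tau 1)); rewrite -tauM !mulg1.
have gG : group_set (couple_subgroup c).
  apply/group_setP; split.
    apply/imset2P; exists 1 1; rewrite ?inE //= tau1.
    by rewrite (morph1 (hol_prod_morphism _ _)).
  move=> _ _ /imset2P[m f _ _ ->] /imset2P[m' g _ _ ->] /=.
  rewrite -hol_prodM mem_couple_subgroup /= groupM ?subgP //=.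
  by rewrite aut_ZpC -tauM subgM ?subgP ?sgvalK.
exists (Group gG) => //; apply/is_regularP; split.
  move=> [m x] [m' x']; have [v Fv vx] := trF x x'.
  pose t := tau (subg F v).
  exists (hol_prod (Hol (m' * (sgval t m)^-1) t, v)).
    by rewrite mem_couple_subgroup /= Fv eqxx.
  by rewrite hol_prod_act vx /hol_act /= mulgKV.
move=> [m x] _ /imset2P[m' f _ _ ->]; rewrite hol_prod_act => -[fm fx].
have f1 : f = 1 by apply: val_inj; apply: freeF fx; apply: subgP.
move: fm; rewrite f1 /= tau1 /hol_act /= perm1 => /(canRL (mulgK _)).
by rewrite mulgV => ->; rewrite (morph1 (hol_prod_morphism _ _)).
Qed.

(** The translations of 'Z_p inside G make the coordinate m free, so all of G
    is recovered from its elements with m neutral. These fix the neutral element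
    of 'Z_p, and regularity on 'Z_p x E then leaves at most one t for each v. *)
Lemma regular_couple p (E : finGroupType) (G : {group hol ('Z_p * E)%type}) :
    coprime #|'Z_p| #|E| -> is_regular G ->
    (forall m : 'Z_p, hol_prod (Hol m 1, 1 : hol E) \in G) ->
  exists F : {group hol E}, exists tau : {ffun [subg F] -> aut_of 'Z_p},
    [/\ is_regular F, tau \in homs p F & couple_subgroup (Couple tau) = G].
Proof.
move=> coZE regG Gtrans; have [trG _] := is_regularP _ regG.
have shift m' m t (v : hol E) :
    hol_prod (Hol m t, v) \in G -> hol_prod (Hol m' t, v) \in G.
  move=> Gmtv; rewrite -(mulgKV m m') -[t]mulg1 -[v]mul1g.
  rewrite -[Hol _ _](_ : Hol (m' * m^-1) 1 * Hol m t = _); last first.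
    by apply: hol_eq => //=; rewrite perm1.
  by rewrite [hol_prod _](hol_prodM (_, _) (_, _)) groupM.
pose F := (snd @* ([morphism of @hol_prod 'Z_p E] @*^-1 G))%G.
have memF v : reflect (exists t, hol_prod (Hol 1 t, v) \in G) (v \in F).
  apply: (iffP morphimP) => [[[[m t] b] _] | [t Gtv]].
    by rewrite !inE => /shift Gtb ->; exists t.
  by exists (Hol 1 t, v); rewrite ?inE.
have tau_uniq t t' v : hol_prod (Hol 1 t, v) \in G ->
    hol_prod (Hol 1 t', v) \in G -> t = t'.
  move=> Gtv Gtv'; have: hol_prod (Hol 1 t, v) = hol_prod (Hol 1 t', v).
    apply: (regular_eq (x := (1, 1)) regG) => //.
    by rewrite !hol_prod_act /hol_act /= !aut1.
  by case/hol_prod_inj.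
(* The default value is never taken: every f in F occurs in G with some t. *)
pose tau : {ffun [subg F] -> aut_of 'Z_p} :=
  [ffun f : [subg F] => odflt 1 [pick t | hol_prod (Hol 1 t, sgval f) \in G]].
have tauP f : hol_prod (Hol 1 (tau f), sgval f) \in G.
  rewrite ffunE; case: pickP => //= noG.
  by have /memF[t] := subgP f; rewrite noG.
exists F, tau; split.
- apply/is_regularP; split=> [x y|x v /memF[t Gtv] vx].
    have [u] := trG (1, x) (1, y).
    case: (hol_prod_onto u coZE) => -[[m t] v] <- /shift Gtv.
    rewrite hol_prod_act => -[_ vxy].
    by exists v => //; apply/memF; exists t.
  suff: hol_prod (Hol 1 t, v) = hol_prod (1, 1) by case/hol_prod_inj.
  apply: (regular_eq (x := (1, x)) regG) => //.
    by rewrite (morph1 (hol_prod_morphism _ _)).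
  by rewrite !hol_prod_act vx !hol_act1 /hol_act aut1 mulg1.
- apply/homsP=> f g; apply: (tau_uniq _ _ (sgval (f * g))) => //.
  have := groupM (tauP f) (tauP g); rewrite -hol_prodM aut_ZpC.
  exact: shift.
apply/setP=> u; case: (hol_prod_onto u coZE) => -[[m t] v] <-.
rewrite mem_couple_subgroup /=; apply/andP/idP => [[Fv /eqP->]|Gmtv].
  by apply: (shift m 1); have := tauP (subg F v); rewrite subgK.
have Fv : v \in F by apply/memF; exists t; apply: shift Gmtv.
split=> //; apply/eqP; apply: (tau_uniq _ _ v); first exact: shift Gmtv.
by have := tauP (subg F v); rewrite subgK.
Qed.

(** * Conjugacy of the subgroups of couples *)

(** Conjugation in Hol('Z_p) preserves the automorphism part of an element, so
    only b is constrained. *)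
Lemma couple_subgroupJ p (E : finGroupType) (c c' : couple p E) a b :
    coprime #|'Z_p| #|E| ->
  couple_subgroup c :^ hol_prod (a, b) = couple_subgroup c' <->
  tag c :^ b = tag c' /\
  {in tag c, forall f,
     tagged c (subg (tag c) f) = tagged c' (subg (tag c') (f ^ b))}.
Proof.
move=> coZE.
have memJ u v : (hol_prod (u, v) \in couple_subgroup c :^ hol_prod (a, b)) =
    (v ^ b^-1 \in tag c) && (hol_aut u == tagged c (subg (tag c) (v ^ b^-1))).
  rewrite mem_conjg.
  rewrite -(morphV (hol_prod_morphism _ _)) ?inE //.
  rewrite -(morphJ (hol_prod_morphism _ _)) ?inE //=.
  by rewrite mem_couple_subgroup hol_autJ.
split=> [/setP eq_cc' | [Fb tauJ]]; last first.
  apply/setP=> w; have [[u v] <-] := hol_prod_onto w coZE.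
  rewrite memJ mem_couple_subgroup -Fb mem_conjg.
  by apply: andb_id2l => /tauJ ->; rewrite conjgKV.
have eqs u v := eq_cc' (hol_prod (u, v)).
split.
  apply/setP=> v; rewrite mem_conjg; apply/idP/idP => Fv.
    have := eqs (Hol 1 (tagged c (subg (tag c) (v ^ b^-1)))) v.
    by rewrite memJ mem_couple_subgroup Fv eqxx => /esym/andP[].
  have := eqs (Hol 1 (tagged c' (subg (tag c') v))) v.
  by rewrite memJ mem_couple_subgroup Fv eqxx => /andP[].
move=> f Ff; have := eqs (Hol 1 (tagged c (subg (tag c) f))) (f ^ b).
by rewrite memJ mem_couple_subgroup /= conjgK Ff eqxx => /esym/andP[_ /eqP].
Qed.

Lemma couple_class_eqP p (E : finGroupType) (c c' : couple p E) :
    coprime #|'Z_p| #|E| ->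
  reflect
    (exists2 b, tag c :^ b = tag c' &
       {in tag c, forall f,
          tagged c (subg (tag c) f) = tagged c' (subg (tag c') (f ^ b))})
    (conj_class (couple_subgroup c) == conj_class (couple_subgroup c')).
Proof.
move=> coZE; apply: (iffP (conj_class_eqP _ _)) => [[w]|[b Fb tauJ]].
  have [[a b] <-] := hol_prod_onto w coZE.
  by case/(couple_subgroupJ _ _ _ _ coZE)=> Fb tauJ; exists b.
by exists (hol_prod (1, b)); apply/couple_subgroupJ.
Qed.

(** The b of couple_class_eqP lies in Hol(E), while sim only allows
    automorphisms of E. By transitivity b^-1 = f0 d with f0 in F and d fixing
    the neutral element, i.e. d in Aut(E); the automorphism part of d is the
    required nu, and the inner automorphism of F given by f0 is invisible to
    tau', whose values commute. *)
Lemma simE p (E : finGroupType) (F : {group hol E}) :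
    coprime #|'Z_p| #|E| -> is_regular F ->
  {in homs p F &, forall tau tau', sim tau tau' =
    (conj_class (couple_subgroup (Couple tau))
       == conj_class (couple_subgroup (Couple tau')))}.
Proof.
move=> coZE /is_regularP[trF _] tau tau' tauH /homsP tauM'.
apply/existsP/(couple_class_eqP (Couple tau) (Couple tau') coZE) => /=.
  case=> nu /andP[/eqP Fnu /forallP tau_nu]; exists (Hol 1 nu)^-1 => // f Ff.
  by have /eqP := tau_nu (subg F f); rewrite subgK.
case=> b Fb tauJ.
have [f0 Ff0 f0b] := trF 1 (hol_act b^-1 1).
pose d := f0^-1 * b^-1.
have d1 : hol_trans d = 1.
  have: hol_act d 1 = 1 by rewrite hol_actM -f0b -hol_actM mulVg hol_act1.
  by rewrite /hol_act aut1 mulg1.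
have dE : Hol 1 (hol_aut d) = d by rewrite -d1; case: (d).
exists (hol_aut d).
have PhiE f : Phi (hol_aut d) f = (f ^ b) ^ f0.
  by rewrite /Phi dE invMg !invgK conjgM.
have nFb f : f \in F -> f ^ b \in F by rewrite -{2}Fb memJ_conjg.
apply/andP; split.
  rewrite -[_ @: _]/(F :^ (Hol 1 (hol_aut d))^-1) dE invMg !invgK conjsgM Fb.
  by rewrite conjGid.
apply/forallP=> f; rewrite PhiE -{1}[f]sgvalK tauJ ?subgP //.
set g := sgval f ^ b; have Fg : g \in F by apply/nFb/subgP.
have -> : subg F (g ^ f0) = subg F g ^ subg F f0.
  exact: (morphJ (subg_morphism F)).
by rewrite conjgE tauM' aut_ZpC -tauM' mulgK.
Qed.

(** * The correspondence *)

Theorem proposition4 (p n : nat) (E : finGroupType)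
    (p_pr : prime p) (n_gt0 : (0 < n)%N) (p_ndvd_n : ~~ (p %| n))
    (normal_p : forall (gT : finGroupType) (G : {group gT}),
       #|G| = (n * p)%N -> exists2 P : {group gT}, P <| G & #|P| = p)
    (E_abelian : abelian [set: E]) (E_card : #|[set: E]| = n)
    (Fs : {set {group hol E}})
    (Fs_reps : representatives (@conj_subgroups (hol E))
                 (regular_subgroups E) Fs)
    (T : forall F : {group hol E}, {set {ffun [subg F] -> aut_of 'Z_p}})
    (T_reps : forall F : {group hol E}, F \in Fs ->
       representatives (@sim p E F) (homs p F) (T F)) :
  [/\ (* each couple gives a regular subgroup of Hol(N) *)
      {in couples Fs T, forall c,
         exists2 G, G \in regular_subgroups ('Z_p * E)%type
                  & couple_subgroup c = G},
      {in couples Fs T &,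
         injective (fun c => conj_class (couple_subgroup c))} &
      [set conj_class (couple_subgroup c) | c in couples Fs T]
        = [set conj_class G | G : {group hol ('Z_p * E)%type}
                              in regular_subgroups ('Z_p * E)%type] ].
Proof.
have cardZ : #|'Z_p| = p by rewrite card_ord Zp_cast ?prime_gt1.
have cardE : #|E| = n by rewrite -cardsT.
have coZE : coprime #|'Z_p| #|E| by rewrite cardZ cardE prime_coprime.
have [sFs Fs_inj Fs_onto] :=
  representativesP (in2W (@conj_subgroupsE (hol E))) Fs_reps.
have regFs F : F \in Fs -> is_regular F by move/sFs; rewrite inE.
have T_repsP F (FsF : F \in Fs) :=
  representativesP (simE coZE (regFs F FsF)) (T_reps F FsF).
have coupleP c : c \in couples Fs T ->
    is_regular (tag c) /\ tagged c \in homs p (tag c).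
  rewrite inE => /andP[Fc Tc]; have [sT _ _] := T_repsP _ Fc.
  by rewrite regFs ?sT.
have regP c : c \in couples Fs T -> exists2 G : {group hol ('Z_p * E)%type},
    G \in regular_subgroups ('Z_p * E)%type & couple_subgroup c = G.
  case/coupleP=> regF tauH.
  have [G regG ->] := couple_subgroup_regular regF tauH.
  by exists G; rewrite ?inE.
split=> //.
  move=> c c'; rewrite !inE => /andP[Fc Tc] /andP[Fc' Tc'] /eqP eq_cc'.
  have /couple_class_eqP[|b Fb _] := eq_cc'; first by [].
  have eqF : tag c = tag c'.
    by apply: Fs_inj => //; apply/eqP/conj_class_eqP; exists b.
  case: c c' eqF => [F tau] [F' tau'] /= eqF in Fc Tc Fc' Tc' eq_cc' {Fb} *.
  case: F' / eqF in tau' Fc' Tc' eq_cc' *.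
  have [_ T_inj _] := T_repsP F Fc.
  by congr (existT _ F _); apply: T_inj => //; apply/eqP.
apply/setP=> K; apply/imsetP/imsetP=> [[c /regP[G regG defG] ->]|[G regG ->]].
  by exists G; rewrite ?defG.
rewrite inE in regG.
have [P nPG cardP] : exists2 P : {group hol ('Z_p * E)%type}, P <| G & #|P| = p.
  by apply: normal_p; rewrite (card_regular regG) card_prod cardE cardZ mulnC.
have p_ndvd_E : ~~ (p %| #|E|) by rewrite cardE.
have Gtrans := regular_translations p_pr p_ndvd_E regG nPG cardP.
have [F [tau [regF /homsP tauM <-]]] := regular_couple coZE regG Gtrans.
(* G comes from (F, tau); tau is transported along b to the representative F0
   of the class of F, and then replaced by its own representative. *)
have [|F0 FsF0 /eqP/conj_class_eqP[b Fb]] := Fs_onto F; first by rewrite inE.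
have FbV f : f \in F0 -> f ^ b^-1 \in F by rewrite -Fb mem_conjg.
pose tau0 : {ffun [subg F0] -> aut_of 'Z_p} :=
  [ffun f => tau (subg F (sgval f ^ b^-1))].
have tau0H : tau0 \in homs p F0.
  apply/homsP=> f g; rewrite !ffunE -tauM -subgM ?FbV ?subgP //.
  by rewrite -conjMg.
have eq_FF0 : conj_class (couple_subgroup (Couple tau))
    = conj_class (couple_subgroup (Couple tau0)).
  apply/eqP/couple_class_eqP => //; exists b => //= f Ff.
  by rewrite ffunE subgK ?conjgK // -Fb memJ_conjg.
have [_ _ T_onto] := T_repsP F0 FsF0.
have [tau1 T1 eq_01] := T_onto tau0 tau0H.
exists (Couple tau1); first by rewrite inE /= FsF0.
by rewrite eq_FF0.
Qed.
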